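(* There exists a linear automorphism $f$ of the vector space $\mathcal{V}_1(\mathbb{F}_2)$ which strongly preserves non-singularity (for all $M\in \mathcal{V}_1(\mathbb{F}_2)$, $f(M)\in \operatorname{GL}_3(\mathbb{F}_2)$ if and only if $M\in\operatorname{GL}_3(\mathbb{F}_2)$) but does not extend to a Frobenius automorphism of $\operatorname{M}_3(\mathbb{F}_2)$.
   Context: $\mathcal{V}_1(\mathbb{F}_2)$ is the linear hyperplane of $\operatorname{M}_3(\mathbb{F}_2)$ consisting of all matrices whose $(3,3)$ entry is zero, i.e. $\mathcal{V}_1(\mathbb{F}_2)=\left\{\begin{bmatrix} M & C \\ L & 0\end{bmatrix} \mid M\in \operatorname{M}_2(\mathbb{F}_2),\ C\in \operatorname{M}_{2,1}(\mathbb{F}_2),\ L\in \operatorname{M}_{1,2}(\mathbb{F}_2)\right\}$. A Frobenius automorphism of $\operatorname{M}_3(\mathbb{F}_2)$ is a map of the form $M\mapsto PMQ$ or of the form $M \mapsto PM^TQ$ for some $P,Q\in\operatorname{GL}_3(\mathbb{F}_2)$. *)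

(* Defs.v *)
From HB Require Import structures.
From mathcomp Require Import all_boot all_order all_algebra.

Set Implicit Arguments.
Unset Strict Implicit.
Unset Printing Implicit Defensive.

Import GRing.Theory.
Local Open Scope ring_scope.

Definition entry33 (F : fieldType) (M : 'M[F]_3) : F^o := M ord_max ord_max.

Fact entry33_is_linear (F : fieldType) : linear (@entry33 F).
Proof. by move=> a A B; rewrite /entry33 !mxE. Qed.

HB.instance Definition _ (F : fieldType) :=
  GRing.isLinear.Build F 'M[F]_3 F^o *:%R (@entry33 F) (@entry33_is_linear F).

(* Indices are 0-based: the (3,3) entry is the one at (ord_max, ord_max). *)
Definition V1 (F : fieldType) : {vspace 'M[F]_3} := lker (linfun (@entry33 F)).

Lemma mem_V1 (F : fieldType) (M : 'M[F]_3) :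
  (M \in V1 F) = (M ord_max ord_max == 0).
Proof. by rewrite memv_ker lfunE. Qed.

Lemma mem_V1_block (F : fieldType) (N : 'M[F]_(2 + 1)) :
  reflect (exists (M : 'M_2) (C : 'M_(2, 1)) (L : 'M_(1, 2)),
             N = block_mx M C L 0)
          ((N : 'M_3) \in V1 F).
Proof.
have e33 (K : 'M[F]_(2 + 1)) :
    (K : 'M_3) ord_max ord_max = drsubmx K ord0 ord0.
  by rewrite !mxE; congr (K _ _); apply: val_inj.
rewrite mem_V1 e33; apply: (iffP eqP) => [N0|[M [C [L ->]]]]; last first.
  by rewrite block_mxKdr mxE.
exists (ulsubmx N), (ursubmx N), (dlsubmx N); rewrite -{1}[N]submxK.
by congr block_mx; apply/matrixP=> i j; rewrite !ord1 N0 mxE.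
Qed.

Definition Frobenius_automorphism (F : fieldType) (n : nat)
    (g : 'M[F]_n -> 'M[F]_n) : Prop :=
  exists P Q : 'M[F]_n, [/\ P \in unitmx, Q \in unitmx &
    (forall M, g M = P *m M *m Q) \/ (forall M, g M = P *m M^T *m Q)].

(* Main.v *)
Require Import Defs.
From HB Require Import structures.
From mathcomp Require Import all_boot all_order all_algebra.

Set Implicit Arguments.
Unset Strict Implicit.
Unset Printing Implicit Defensive.

Import GRing.Theory.
Local Open Scope ring_scope.

(** With rows and columns numbered from 0, the automorphism is the shear
    [f M = M + (s + t) E_00], where [s = M_12] and [t = M_21].  It stabilizes
    the hyperplane [M_22 = 0] and is an involution in characteristic 2.
    Expanding along row 0, it changes the determinant by [s + t] times the
    (0,0) minor, which is [- s t] on the hyperplane; and the polynomial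
    [(s + t) s t = s^2 t + s t^2] vanishes identically as a function on [F_2]
    (lemma [det_shear_mx]).  Hence [f] even preserves the determinant.

    On the other hand, Frobenius automorphisms preserve the rank
    ([Frobenius_rank]), whereas [f] maps the rank 1 matrix [E_12] to
    [E_00 + E_12], which has rank 2 ([rank_shear_delta]). *)

(** The shear [M + (M_12 + M_21) E_00], on all 3 x 3 matrices. *)
Definition shear_mx (F : fieldType) (M : 'M[F]_3) : 'M[F]_3 :=
  M + (M 1 ord_max + M ord_max 1) *: delta_mx 0 0.

Fact shear_mx_is_linear (F : fieldType) : linear (@shear_mx F).
Proof.
move=> a A B; rewrite /shear_mx scalerDr [RHS]addrACA scalerA -scalerDl.
by rewrite !mxE mulrDr addrACA.
Qed.

HB.instance Definition _ (F : fieldType) :=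
  GRing.isLinear.Build F 'M[F]_3 'M[F]_3 *:%R (@shear_mx F)
    (@shear_mx_is_linear F).

Lemma shear_mx_out (F : fieldType) (M : 'M[F]_3) i j :
  (i != 0) || (j != 0) -> shear_mx M i j = M i j.
Proof.
by rewrite -negb_and !mxE => /negPf ->; rewrite mulr0 addr0.
Qed.

Lemma shear_mx_V1 (F : fieldType) (M : 'M[F]_3) :
  M \in V1 F -> shear_mx M \in V1 F.
Proof. by rewrite !mem_V1 shear_mx_out. Qed.

Lemma addmx_F2 (m n : nat) (A : 'M['F_2]_(m, n)) : A + A = 0.
Proof. by apply/matrixP=> i j; rewrite !mxE addrr_pchar2 // pchar_Fp. Qed.

Lemma shear_mxK : involutive (@shear_mx 'F_2).
Proof.
move=> M; rewrite {1}/shear_mx !shear_mx_out // /shear_mx -addrA addmx_F2.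
exact: addr0.
Qed.

Lemma det_shear_mx_V1 (F : fieldType) (M : 'M[F]_3) : M \in V1 F ->
  let s := M 1 ord_max in let t := M ord_max 1 in
  \det (shear_mx M) = \det M - (s + t) * (s * t).
Proof.
rewrite mem_V1 => /eqP M22 /=.
(* The two matrices agree outside row 0, hence have the same cofactors there. *)
have cofE j : cofactor (shear_mx M) 0 j = cofactor M 0 j.
  congr (_ * \det _); apply/matrixP=> i k.
  rewrite [LHS]mxE [LHS]mxE [RHS]mxE [RHS]mxE.
  by rewrite shear_mx_out // eq_sym neq_lift.
have cof00 : cofactor M 0 0 = - (M 1 ord_max * M ord_max 1).
  rewrite /cofactor expr0 mul1r (expand_det_row _ 0) !big_ord_recl big_ord0.
  rewrite /cofactor !det_mx11 !mxE /= expr0 expr1 mul1r addr0.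
  transitivity (M 1 1 * M ord_max ord_max - M 1 ord_max * M ord_max 1).
    rewrite mulN1r mulrN.
    by congr (M _ _ * M _ _ - M _ _ * M _ _); apply: val_inj.
  by rewrite M22 mulr0 sub0r.
rewrite !(expand_det_row _ 0) -mulrN -cof00.
under eq_bigr do rewrite cofE.
rewrite [LHS](bigD1 0) // [in RHS](bigD1 0) //= [in LHS]mxE !mxE !eqxx mulr1.
rewrite mulrDl addrAC; congr (_ + _ + _).
by apply: eq_bigr => j j0; rewrite shear_mx_out // j0 orbT.
Qed.

Lemma det_shear_mx (M : 'M['F_2]_3) :
  M \in V1 'F_2 -> \det (shear_mx M) = \det M.
Proof.
move=> /det_shear_mx_V1 ->; move: (M 1 _) (M _ 1) => s t.
suff -> : (s + t) * (s * t) = 0 by rewrite subr0.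
by apply/eqP; case: s t => [[|[|//]] ?] [[|[|//]] ?].
Qed.

Lemma Frobenius_rank (F : fieldType) (n : nat) (g : 'M[F]_n -> 'M[F]_n) M :
  Frobenius_automorphism g -> \rank (g M) = \rank M.
Proof.
move=> [P [Q [uP uQ gE]]].
have rPQ A : \rank (P *m A *m Q) = \rank A.
  rewrite mxrankMfree ?row_free_unit // -mxrank_tr trmx_mul.
  by rewrite mxrankMfree ?mxrank_tr // row_free_unit unitmx_tr.
by case: gE => ->; rewrite rPQ ?mxrank_tr.
Qed.

Lemma rank_shear_delta (F : fieldType) :
  (1 < \rank (shear_mx (delta_mx 1 ord_max : 'M[F]_3))%R)%N.
Proof.
set A := shear_mx _.
have AE : A = delta_mx 1 ord_max + delta_mx 0 0.
  by rewrite /A /shear_mx !mxE /= addr0 scale1r.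
(* As A A^T = E_00 + E_11 has rank 2, A has rank at least 2. *)
have AAt : A *m A^T = pid_mx 2.
  rewrite AE linearD /= !trmx_delta mulmxDl !mulmxDr !mul_delta_mx_cond /=.
  apply/matrixP=> -[[|[|[|//]]] ?] [[|[|[|//]]] ?];
  by rewrite !mxE /= ?addr0 ?add0r.
by apply: leq_trans (mxrankM_maxl A A^T); rewrite AAt rank_pid_mx.
Qed.

Theorem proposition17 :
  exists f : {linear subvs_of (V1 'F_2) -> subvs_of (V1 'F_2)},
    [/\ bijective f,
        (forall M : subvs_of (V1 'F_2),
           vsval (f M) \in unitmx <-> vsval M \in unitmx)
      & ~ (exists g : 'M['F_2]_3 -> 'M['F_2]_3,
             Frobenius_automorphism g /\
             (forall M : subvs_of (V1 'F_2), g (vsval M) = vsval (f M)))].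
Proof.
pose f : {linear subvs_of (V1 'F_2) -> subvs_of (V1 'F_2)} :=
  vsproj (V1 'F_2) \o (@shear_mx 'F_2 \o vsval).
have fE M : vsval (f M) = shear_mx (vsval M).
  by rewrite /= vsprojK // shear_mx_V1 // subvsP.
exists f; split.
- by exists f => M; apply: val_inj; apply: etrans (fE _) _; rewrite fE shear_mxK.
- by move=> M; rewrite fE !unitmxE det_shear_mx // subvsP.
move=> [g [gF gE]].
have E12 : delta_mx 1 ord_max \in V1 'F_2 by rewrite mem_V1 mxE.
have := rank_shear_delta 'F_2.
rewrite -(vsprojK E12) -fE -gE (Frobenius_rank _ gF) vsprojK //.
by rewrite mxrank_delta.
Qed.
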